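(* Let $\mathcal{F}\subseteq\{0',1,{}^{-1},{}^{c},\pi,\bar\pi,-,/,\backslash\}$ contain ${}^{c}$ (complement) or $-$ (set difference), and let $k$ be a natural number. For any marked structures $\mathbf{G}_1=(G_1,a_1,b_1)$ and $\mathbf{G}_2=(G_2,a_2,b_2)$ (finite or infinite), $\mathbf{G}_1$ and $\mathbf{G}_2$ are $(\mathcal{F},k)$-bisimilar if and only if $\mathbf{G}_1\equiv^{\mathcal{F}}_k\mathbf{G}_2$.
   Context: Fix a finite set $\Lambda$ of relation names. A structure is $G=(V,(R^G)_{R\in\Lambda})$ with $V$ a set of nodes and each $R^G\subseteq V\times V$. Expressions are built from relation names and the constants $0,1,0',1'$ using $\cup,\cap,\circ$ (composition), $-$ (difference), $/$ (left residual), $\backslash$ (right residual), ${}^c$ (complement), ${}^{-1}$ (converse), $\pi_1,\pi_2$ (projections), $\bar\pi_1,\bar\pi_2$ (coprojections). On $G$ with node set $V$: $R(G)=R^G$, $0(G)=\emptyset$, $1(G)=V^2$, $0'(G)=\{(s,t)\in V^2:s\neq t\}$, $1'(G)=\{(s,s):s\in V\}$; $\cup,\cap,-$ are set operations; $e^c(G)=V^2\setminus e(G)$; $(e_1\circ e_2)(G)=\{(s,t):\exists v\,((s,v)\in e_1(G)\wedge (v,t)\in e_2(G))\}$; $e^{-1}(G)=\{(s,t):(t,s)\in e(G)\}$; $\pi_1(e)(G)=\{(s,s):\exists t\,(s,t)\in e(G)\}$, $\pi_2(e)(G)=\{(s,s):\exists t\,(t,s)\in e(G)\}$; $\bar\pi_1(e)(G)=\{(s,s):s\in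 V,\neg\exists t\,(s,t)\in e(G)\}$, $\bar\pi_2(e)(G)=\{(s,s):s\in V,\neg\exists t\,(t,s)\in e(G)\}$; $(e_1/e_2)(G)=\{(s,t)\in V^2:\forall v\in V\,((t,v)\in e_2(G)\to(s,v)\in e_1(G))\}$; $(e_1\backslash e_2)(G)=\{(s,t)\in V^2:\forall v\in V\,((v,s)\in e_1(G)\to(v,t)\in e_2(G))\}$. For $\mathcal{F}\subseteq\{0',1,{}^{-1},{}^c,\pi,\bar\pi,-,/,\backslash\}$, the fragment $\mathcal{C}(\mathcal{F})$ consists of expressions built from relation names, $0$, $1'$ and the constants in $\mathcal{F}$ using $\circ,\cup,\cap$ and the operations in $\mathcal{F}$ ($\pi$ meaning both $\pi_1,\pi_2$; $\bar\pi$ both $\bar\pi_1,\bar\pi_2$). Degree: relation names and constants have degree $0$; $\cup,\cap,-$ take the maximum of the degrees of the arguments; ${}^c,{}^{-1}$ keep the degree; $\circ,/,\backslash$ give $1+$ the maximum; $\pi_i,\bar\pi_i$ add $1$. $\mathcal{C}(\mathcal{F})_k$ is the set of expressions in $\mathcal{C}(\mathcal{F})$ of degree $\le k$. Paths: for $G$, let $E_G=\bigcup_{R\in\Lambda}R^G$; $\mathrm{paths}_k(G)$ is the set of $(x,y)\in V^2$ joined by a directed path of length at most $2^k$ in $(V,E_G)$ (length $0$ allowed), and $\mathrm{upaths}_k(G)$ the same in the undirected graph with edges $\{x,y\}$ for $(x,y)\in E_G$. ''1 is present at degree 0'' if $\mathcal{F}$ contains $1$, $0'$ or ${}^c$; ''present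 at degree 1'' if not at degree 0 and $\mathcal{F}$ contains $/$ or $\backslash$; ''absent'' otherwise. $\mathrm{paths}^{\mathcal{F}}_k(G)$: if 1 is absent, it is $\mathrm{paths}_k(G)$ when ${}^{-1}\notin\mathcal{F}$ and $\mathrm{upaths}_k(G)$ when ${}^{-1}\in\mathcal{F}$; if 1 is present at degree 1, it is as in the absent case for $k=0$ and $V^2$ for $k>0$; if present at degree 0, it is $V^2$ for all $k$. A marked structure is $(G,a,b)$ with $a,b$ nodes of $G$. $(G_1,a_1,b_1)\equiv^{\mathcal{F}}_k(G_2,a_2,b_2)$ means: for every $e\in\mathcal{C}(\mathcal{F})_k$, $(a_1,b_1)\in e(G_1)$ iff $(a_2,b_2)\in e(G_2)$. Atomic expressions are $1',0',R,R^{-1}$ ($R\in\Lambda$); $\mathrm{aexp}(\mathcal{F})$ are those belonging to $\mathcal{C}(\mathcal{F})$; the atomic type is $\mathrm{atp}^{\mathcal{F}}(G,a,b)=\{e\in\mathrm{aexp}(\mathcal{F}):(a,b)\in e(G)\}$. Bisimulation. Let $G_1,G_2$ have node sets $V_1,V_2$, $Z\subseteq V_1^2\times V_2^2$, $(a_1,b_1,a_2,b_2)\in V_1^2\times V_2^2$, $i>0$, and write $P_j=\mathrm{paths}^{\mathcal{F}}_{i-1}(G_j)$. Properties (at degree $i$ w.r.t. $Z$): Atoms Forth: $\mathrm{atp}^{\mathcal{F}}(G_1,a_1,b_1)\subseteq\mathrm{atp}^{\mathcal{F}}(G_2,a_2,b_2)$; Atoms Back: $\supseteq$. Composition Forth: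 for every $c_1\in V_1$ with $(a_1,c_1),(c_1,b_1)\in P_1$ there is $c_2\in V_2$ with $(a_1,c_1,a_2,c_2)\in Z$ and $(c_1,b_1,c_2,b_2)\in Z$. Composition Back: for every $c_2\in V_2$ with $(a_2,c_2),(c_2,b_2)\in P_2$ there is $c_1\in V_1$ with both those tuples in $Z$. Projection Forth: either $a_1\neq b_1$, or ($a_1=b_1$, $a_2=b_2$, and for every $c_1$ with $(a_1,c_1)\in P_1$ there is $c_2$ with $(a_1,c_1,a_2,c_2)\in Z$); moreover if $a_1=b_1$, for every $c_1$ with $(c_1,a_1)\in P_1$ there is $c_2$ with $(c_1,a_1,c_2,a_2)\in Z$. Projection Back: the same with the roles of the indices $1,2$ swapped (either $a_2\neq b_2$, or $a_2=b_2$, $a_1=b_1$ and for every $c_2$ with $(a_2,c_2)\in P_2$ there is $c_1$ with $(a_1,c_1,a_2,c_2)\in Z$; moreover if $a_2=b_2$, for every $c_2$ with $(c_2,a_2)\in P_2$ there is $c_1$ with $(c_1,a_1,c_2,a_2)\in Z$). Left Residual Forth: for every $c_2$ with $(b_2,c_2)\in P_2$ there is $c_1$ with $(b_1,c_1,b_2,c_2)\in Z$ and either $(a_1,c_1)\notin P_1$ or $(a_1,c_1,a_2,c_2)\in Z$. Left Residual Back: for every $c_1$ with $(b_1,c_1)\in P_1$ there is $c_2$ with $(b_1,c_1,b_2,c_2)\in Z$ and either $(a_2,c_2)\notin P_2$ or $(a_1,c_1,a_2,c_2)\in Z$. Right Residual Forth: for every $c_2$ with $(c_2,a_2)\in P_2$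 there is $c_1$ with $(c_1,a_1,c_2,a_2)\in Z$ and either $(c_1,b_1)\notin P_1$ or $(c_1,b_1,c_2,b_2)\in Z$. Right Residual Back: for every $c_1$ with $(c_1,a_1)\in P_1$ there is $c_2$ with $(c_1,a_1,c_2,a_2)\in Z$ and either $(c_2,b_2)\notin P_2$ or $(c_1,b_1,c_2,b_2)\in Z$. An $(\mathcal{F},k)$-bisimulation from $G_1$ to $G_2$ is a sequence $Z_0\supseteq Z_1\supseteq\dots\supseteq Z_k$ of subsets of $V_1^2\times V_2^2$ such that every element of $Z_0$ has Atoms Forth and Back, and for each $i\in\{1,\dots,k\}$ every element of $Z_i$ has, at degree $i$ w.r.t. $Z_{i-1}$, Composition Forth and Back, Projection Forth and Back if $\pi\in\mathcal{F}$, and Left (Right) Residual Forth and Back if $/$ ($\backslash$) $\in\mathcal{F}$. $(G_1,a_1,b_1)$ and $(G_2,a_2,b_2)$ are $(\mathcal{F},k)$-bisimilar if there is such a sequence with $(a_1,b_1,a_2,b_2)\in Z_k$.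
   Formalization: Bisimilarity uses an enlarged F when 0', 1, ^c are not in F: π is added if π̄ is in F, ^{-1} is not, and / or \ is missing; both / and \ are added if ^{-1} and one of them are in F. Unmended, the claim fails, e.g. for F={π̄,−} or F={^{-1},−,/} with k=1. *)

(* Defs.v *)
From mathcomp Require Import all_boot.

Set Implicit Arguments.
Unset Strict Implicit.
Unset Printing Implicit Defensive.

(* Node sets are arbitrary types, so structures may be infinite (or empty). *)
Record structure (L : finType) := Structure {
  node : Type;
  edge : L -> node -> node -> Prop
}.

Record marked (L : finType) := Marked {
  base : structure L;
  mark1 : node base;
  mark2 : node base
}.

(* FDiv is the diversity 0', FDiff is set difference, FLres is /, FRres is \. *)
Inductive feature :=
  FDiv | FOne | FConv | FCompl | FProj | FCoproj | FDiff | FLres | FRres.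

Inductive expr (L : finType) :=
| ERel of L
| EZero
| EOne
| EDiv
| EId
| EUnion of expr L & expr L
| EInter of expr L & expr L
| EComp of expr L & expr L
| EDiff of expr L & expr L
| ELres of expr L & expr L
| ERres of expr L & expr L
| ECompl of expr L
| EConv of expr L
| EProj1 of expr L
| EProj2 of expr L
| ECoproj1 of expr L
| ECoproj2 of expr L.

Arguments EZero {L}.
Arguments EOne {L}.
Arguments EDiv {L}.
Arguments EId {L}.

Fixpoint eval (L : finType) (G : structure L) (e : expr L) (s t : node G) :
    Prop :=
  match e with
  | ERel R => edge R s t
  | EZero => False
  | EOne => True
  | EDiv => s <> t
  | EId => s = t
  | EUnion e1 e2 => eval e1 s t \/ eval e2 s t
  | EInter e1 e2 => eval e1 s t /\ eval e2 s t
  | EComp e1 e2 => exists v, eval e1 s v /\ eval e2 v t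
  | EDiff e1 e2 => eval e1 s t /\ ~ eval e2 s t
  | ELres e1 e2 => forall v, eval e2 t v -> eval e1 s v
  | ERres e1 e2 => forall v, eval e1 v s -> eval e2 v t
  | ECompl e1 => ~ eval e1 s t
  | EConv e1 => eval e1 t s
  | EProj1 e1 => s = t /\ exists v, eval e1 s v
  | EProj2 e1 => s = t /\ exists v, eval e1 v s
  | ECoproj1 e1 => s = t /\ ~ exists v, eval e1 s v
  | ECoproj2 e1 => s = t /\ ~ exists v, eval e1 v s
  end.

Fixpoint in_fragment (L : finType) (F : {pred feature}) (e : expr L) : bool :=
  match e with
  | ERel _ | EZero | EId => true
  | EOne => FOne \in F
  | EDiv => FDiv \in F
  | EUnion e1 e2 | EInter e1 e2 | EComp e1 e2 =>
      in_fragment F e1 && in_fragment F e2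
  | EDiff e1 e2 => [&& FDiff \in F, in_fragment F e1 & in_fragment F e2]
  | ELres e1 e2 => [&& FLres \in F, in_fragment F e1 & in_fragment F e2]
  | ERres e1 e2 => [&& FRres \in F, in_fragment F e1 & in_fragment F e2]
  | ECompl e1 => (FCompl \in F) && in_fragment F e1
  | EConv e1 => (FConv \in F) && in_fragment F e1
  | EProj1 e1 | EProj2 e1 => (FProj \in F) && in_fragment F e1
  | ECoproj1 e1 | ECoproj2 e1 => (FCoproj \in F) && in_fragment F e1
  end.

Fixpoint degree (L : finType) (e : expr L) : nat :=
  match e with
  | ERel _ | EZero | EOne | EDiv | EId => 0
  | EUnion e1 e2 | EInter e1 e2 | EDiff e1 e2 => maxn (degree e1) (degree e2)
  | EComp e1 e2 | ELres e1 e2 | ERres e1 e2 =>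
      (maxn (degree e1) (degree e2)).+1
  | ECompl e1 | EConv e1 => degree e1
  | EProj1 e1 | EProj2 e1 | ECoproj1 e1 | ECoproj2 e1 => (degree e1).+1
  end.

Definition equiv_upto (L : finType) (F : {pred feature}) (k : nat)
    (M1 M2 : marked L) : Prop :=
  forall e : expr L, in_fragment F e -> degree e <= k ->
    (eval e (mark1 M1) (mark2 M1) <-> eval e (mark1 M2) (mark2 M2)).

Definition arc (L : finType) (G : structure L) (x y : node G) : Prop :=
  exists R : L, edge R x y.

Fixpoint walk (V : Type) (E : V -> V -> Prop) (n : nat) (x y : V) : Prop :=
  if n is m.+1 then exists z, E x z /\ walk E m z y else x = y.

Definition paths (L : finType) (k : nat) (G : structure L) (x y : node G) :
    Prop :=
  exists2 n, n <= 2 ^ k & walk (@arc L G) n x y.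

Definition upaths (L : finType) (k : nat) (G : structure L) (x y : node G) :
    Prop :=
  exists2 n, n <= 2 ^ k & walk (fun u v : node G => arc u v \/ arc v u) n x y.

Definition one_at0 (F : {pred feature}) : bool :=
  [|| FOne \in F, FDiv \in F | FCompl \in F].

Definition one_at1 (F : {pred feature}) : bool :=
  ~~ one_at0 F && ((FLres \in F) || (FRres \in F)).

Definition pathsF (L : finType) (F : {pred feature}) (k : nat)
    (G : structure L) (x y : node G) : Prop :=
  if one_at0 F || (one_at1 F && (0 < k)) then True
  else if FConv \in F then upaths k x y else paths k x y.

Definition atomic (L : finType) (e : expr L) : bool :=
  match e with
  | EId | EDiv | ERel _ | EConv (ERel _) => true
  | _ => false
  end.

Definition atp (L : finType) (F : {pred feature}) (G : structure L)
    (a b : node G) (e : expr L) : Prop :=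
  [/\ atomic e, in_fragment F e & eval e a b].

Section BisimulationProperties.

Variables (L : finType) (F : {pred feature}) (G1 G2 : structure L).

Definition quaternary := node G1 -> node G1 -> node G2 -> node G2 -> Prop.

(* Below, [i] is one less than the degree at which the property is taken, so
   that [P1] and [P2] are the path relations of the two structures at [i]. *)
Variables (i : nat) (Z : quaternary).

Let P1 (x y : node G1) : Prop := pathsF F i x y.
Let P2 (x y : node G2) : Prop := pathsF F i x y.

Variables (a1 b1 : node G1) (a2 b2 : node G2).

Definition atoms_forth : Prop :=
  forall e : expr L, atp F a1 b1 e -> atp F a2 b2 e.

Definition atoms_back : Prop :=
  forall e : expr L, atp F a2 b2 e -> atp F a1 b1 e.

Definition comp_forth : Prop :=
  forall c1, P1 a1 c1 -> P1 c1 b1 ->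
    exists c2, Z a1 c1 a2 c2 /\ Z c1 b1 c2 b2.

Definition comp_back : Prop :=
  forall c2, P2 a2 c2 -> P2 c2 b2 ->
    exists c1, Z a1 c1 a2 c2 /\ Z c1 b1 c2 b2.

Definition proj_forth : Prop :=
  (a1 <> b1 \/
   [/\ a1 = b1, a2 = b2 & forall c1, P1 a1 c1 -> exists c2, Z a1 c1 a2 c2]) /\
  (a1 = b1 -> forall c1, P1 c1 a1 -> exists c2, Z c1 a1 c2 a2).

Definition proj_back : Prop :=
  (a2 <> b2 \/
   [/\ a2 = b2, a1 = b1 & forall c2, P2 a2 c2 -> exists c1, Z a1 c1 a2 c2]) /\
  (a2 = b2 -> forall c2, P2 c2 a2 -> exists c1, Z c1 a1 c2 a2).

Definition lres_forth : Prop :=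
  forall c2, P2 b2 c2 ->
    exists c1, Z b1 c1 b2 c2 /\ (~ P1 a1 c1 \/ Z a1 c1 a2 c2).

Definition lres_back : Prop :=
  forall c1, P1 b1 c1 ->
    exists c2, Z b1 c1 b2 c2 /\ (~ P2 a2 c2 \/ Z a1 c1 a2 c2).

Definition rres_forth : Prop :=
  forall c2, P2 c2 a2 ->
    exists c1, Z c1 a1 c2 a2 /\ (~ P1 c1 b1 \/ Z c1 b1 c2 b2).

Definition rres_back : Prop :=
  forall c1, P1 c1 a1 ->
    exists c2, Z c1 a1 c2 a2 /\ (~ P2 c2 b2 \/ Z c1 b1 c2 b2).

End BisimulationProperties.

(* Only [Z 0], ..., [Z k] are constrained. *)
Definition bisimulation (L : finType) (F : {pred feature}) (k : nat)
    (G1 G2 : structure L) (Z : nat -> quaternary G1 G2) : Prop :=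
  [/\ forall i, i < k ->
        forall a1 b1 a2 b2, Z i.+1 a1 b1 a2 b2 -> Z i a1 b1 a2 b2,
      forall a1 b1 a2 b2, Z 0 a1 b1 a2 b2 ->
        atoms_forth F a1 b1 a2 b2 /\ atoms_back F a1 b1 a2 b2
    & forall i, i < k -> forall a1 b1 a2 b2, Z i.+1 a1 b1 a2 b2 ->
        [/\ comp_forth F i (Z i) a1 b1 a2 b2 /\
              comp_back F i (Z i) a1 b1 a2 b2,
            FProj \in F ->
              proj_forth F i (Z i) a1 b1 a2 b2 /\
              proj_back F i (Z i) a1 b1 a2 b2,
            FLres \in F ->
              lres_forth F i (Z i) a1 b1 a2 b2 /\
              lres_back F i (Z i) a1 b1 a2 b2
          & FRres \in F ->
              rres_forth F i (Z i) a1 b1 a2 b2 /\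
              rres_back F i (Z i) a1 b1 a2 b2]].

Definition bisimilar (L : finType) (F : {pred feature}) (k : nat)
    (M1 M2 : marked L) : Prop :=
  exists2 Z : nat -> quaternary (base M1) (base M2),
    bisimulation F k Z & Z k (mark1 M1) (mark2 M1) (mark1 M2) (mark2 M2).

(* The clauses of [bisimulation] are triggered by pi, / and \ literally.  With
   difference in F but 1 not available at degree 0, some of these operations
   can be definable in the fragment at the same degree without belonging to F,
   and then no other clause accounts for them:
     pi_i(e) = 1' - copi_i(e),
     e1 / e2 = (e2^-1 \ e1^-1)^-1   and   e1 \ e2 = (e2^-1 / e1^-1)^-1.
   Indeed ({copi,-},1)-bisimilarity does not imply equivalence (an R-edge
   x -> y marked at (x,x), against a lone node), nor does
   ({^-1,-,/},1)-bisimilarity (an R-edge x -> y and an isolated z, marked at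
   (x,z), against two isolated nodes).  [saturate] adds exactly the missing
   operations; it leaves F unchanged whenever the literal clauses suffice, in
   particular whenever F contains complement, 1 or 0', or contains pi but not
   converse. *)
Definition needs_proj (F : {pred feature}) : bool :=
  [&& ~~ one_at0 F, FCoproj \in F, FConv \notin F
    & ~~ ((FLres \in F) && (FRres \in F))].

Definition needs_res (F : {pred feature}) : bool :=
  [&& ~~ one_at0 F, FConv \in F & (FLres \in F) || (FRres \in F)].

Definition saturate (F : {pred feature}) : {pred feature} :=
  fun f => (f \in F) ||
    match f with
    | FProj => needs_proj F
    | FLres | FRres => needs_res F
    | _ => false
    end.

(* Main.v *)
Require Import Defs.
From mathcomp Require Import all_boot.
From HB Require Import structures.
From mathcomp Require Import boolp.

(* From bisimilarity to equivalence, one inducts on expressions; the witnesses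
   that the operators ask for stay inside the bisimulation because an expression
   of degree at most i only relates nodes that are i-path-related.  Conversely,
   no finite-index argument for equivalence is needed: fix for every degree i a
   finite list of expressions (basis i) and let Z_i be agreement on that list.
   By complement or difference, the class of an i-path-related pair under Z_i is
   defined by an expression of degree i, and basis (i+1) consists of basis i and
   of the compositions, projections and residuals of such expressions, which is
   just what refutes a failure of a bisimulation clause. *)

Set Implicit Arguments.
Unset Strict Implicit.
Unset Printing Implicit Defensive.

(** Membership in a list of expressions needs an equality test; the classical one suffices, since
    nothing is computed with it. *)
HB.instance Definition _ (L : finType) := gen_eqMixin (expr L).

(** * Bounded walks *)

(** Both [paths] and [upaths] unfold to instances of this, so facts about walks are proved once for
    an arbitrary edge relation. *)
Definition bounded_walk (V : Type) (E : V -> V -> Prop) (k : nat) (x y : V) :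
    Prop :=
  exists2 n, n <= 2 ^ k & walk E n x y.

Lemma walk_cat (V : Type) (E : V -> V -> Prop) m n x y z :
  walk E m x y -> walk E n y z -> walk E (m + n) x z.
Proof.
elim: m x => [|m IHm] x /=; first by move->.
by case=> w [Exw Hw] Hn; exists w; split=> //; apply: IHm.
Qed.

Lemma walk_split (V : Type) (E : V -> V -> Prop) m n x z :
  walk E (m + n) x z -> exists2 y, walk E m x y & walk E n y z.
Proof.
elim: m x => [|m IHm] x /=; first by exists x.
by case=> w [Exw /IHm [y Hm Hn]]; exists y => //; exists w.
Qed.

Lemma walk_sym (V : Type) (E : V -> V -> Prop) n x y :
  (forall u v, E u v -> E v u) -> walk E n x y -> walk E n y x.
Proof.
move=> symE; elim: n x => [|n IHn] x; first by move=> /= ->.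
case=> z [Exz /IHn Hz]; rewrite -addn1; apply: walk_cat Hz _.
by exists x; split=> //; apply: symE.
Qed.

Lemma bounded_walk0 (V : Type) (E : V -> V -> Prop) x y :
  bounded_walk E 0 x y <-> x = y \/ E x y.
Proof.
split=> [[[|[|n]] //= _]|[->|Exy]]; first by left.
- by case=> z [Exz <-]; right.
- by exists 0.
- by exists 1 => //; exists y.
Qed.

Lemma bounded_walkS (V : Type) (E : V -> V -> Prop) k x z :
  bounded_walk E k.+1 x z <->
  exists y, bounded_walk E k x y /\ bounded_walk E k y z.
Proof.
split=> [[n len_n]|[y [[m len_m Hm] [n len_n Hn]]]]; last first.
  exists (m + n); last exact: walk_cat Hm Hn.
  by rewrite expnS mul2n -addnn leq_add.
(* The walk is cut after [minn n (2 ^ k)] steps. What remains is at most [2 ^ k] long because [n] is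
   at most twice that bound; a short walk leaves an empty second half. *)
rewrite -{1}(subnKC (geq_minl n (2 ^ k))) => Hn.
have [y Hm Hn'] := walk_split Hn; exists y.
split; first by exists (minn n (2 ^ k)); rewrite ?geq_minr.
exists (n - minn n (2 ^ k)) => //.
rewrite leq_subLR; case: (leqP n (2 ^ k)) => [_|_]; first exact: leq_addr.
by rewrite addnn -mul2n -expnS.
Qed.

Lemma bounded_walk_refl (V : Type) (E : V -> V -> Prop) k x :
  bounded_walk E k x x.
Proof. by exists 0. Qed.

(** * The path relations *)

Lemma pathsF_at0 (L : finType) (F : {pred feature}) i (G : structure L)
  (x y : node G) : one_at0 F -> pathsF F i x y.
Proof. by rewrite /pathsF => ->. Qed.

Lemma pathsF_res (L : finType) (F : {pred feature}) i (G : structure L)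
  (x y : node G) : (FLres \in F) || (FRres \in F) -> 0 < i -> pathsF F i x y.
Proof. by rewrite /pathsF /one_at1 => -> ->; case: (one_at0 F). Qed.

Lemma pathsF_refl (L : finType) (F : {pred feature}) i (G : structure L)
  (x : node G) : pathsF F i x x.
Proof.
by rewrite /pathsF; case: ifP => // _; case: ifP => _; apply: bounded_walk_refl.
Qed.

Lemma pathsF_sym (L : finType) (F : {pred feature}) i (G : structure L)
  (x y : node G) : FConv \in F -> pathsF F i x y -> pathsF F i y x.
Proof.
rewrite /pathsF => ->; case: ifP => // _ [n le_n Hn]; exists n => //.
by apply: walk_sym Hn => u v [?|?]; [right|left].
Qed.

Lemma pathsF_comp (L : finType) (F : {pred feature}) i (G : structure L)
  (x y z : node G) : pathsF F i x y -> pathsF F i y z -> pathsF F i.+1 x z.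
Proof.
rewrite /pathsF andbT; case: (one_at0 F); case: (one_at1 F) => //=.
by case: ifP => _ Hxy Hyz; apply/bounded_walkS; exists y.
Qed.

(** * Effect of saturation on the path relations, and the reach of an expression of bounded
    degree *)

Lemma in_saturate (F : {pred feature}) f :
  (f \in saturate F) = (f \in F) ||
    match f with
    | FProj => needs_proj F
    | FLres | FRres => needs_res F
    | _ => false
    end.
Proof. by []. Qed.

Lemma sub_saturate (F : {pred feature}) f : f \in F -> f \in saturate F.
Proof. by rewrite in_saturate => ->. Qed.

Lemma one_at0_saturate (F : {pred feature}) : one_at0 (saturate F) = one_at0 F.
Proof. by rewrite /one_at0 !in_saturate !orbF. Qed.

(** Saturation adds a residual only where one is already present, and it never adds converse, [1],
    [0'] or complement; hence both the level at which 1 appears and the kind of path are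
    unchanged. *)
Lemma pathsF_saturate (L : finType) (F : {pred feature}) i (G : structure L)
  (x y : node G) : pathsF (saturate F) i x y = pathsF F i x y.
Proof.
rewrite /pathsF /one_at1 one_at0_saturate !in_saturate orbF /needs_res.
by case: (one_at0 F); case: (FConv \in F); case: (FLres \in F);
   case: (FRres \in F).
Qed.

(** Operations that can relate distant nodes ([1], [0'], complement, residuals) make [pathsF] the
    full relation from the degree at which they can occur. Composition costs one degree, which
    doubles the length bound; converse comes with undirected paths. *)
Lemma eval_pathsF (L : finType) (F : {pred feature}) (e : expr L) i
  (G : structure L) (x y : node G) :
  in_fragment F e -> degree e <= i -> eval e x y -> pathsF F i x y.
Proof.
elim: e i x y => [R|||||e1 IH1 e2 IH2|e1 IH1 e2 IH2|e1 IH1 e2 IH2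
  |e1 IH1 e2 IH2|e1 IH1 e2 IH2|e1 IH1 e2 IH2|e1 IH1|e1 IH1|e1 IH1|e1 IH1
  |e1 IH1|e1 IH1] i x y /=.
- move=> _ _ Rxy; rewrite /pathsF; case: ifP => // _; case: ifP => _.
    by exists 1; rewrite ?expn_gt0 //; exists y; split=> //; left; exists R.
  by exists 1; rewrite ?expn_gt0 //; exists y; split=> //; exists R.
- by [].
- by move=> H1 _ _; apply: pathsF_at0; rewrite /one_at0 H1.
- by move=> H1 _ _; apply: pathsF_at0; rewrite /one_at0 H1 orbT.
- by move=> _ _ ->; apply: pathsF_refl.
- by case/andP=> f1 f2; rewrite geq_max => /andP[d1 d2] [/(IH1 i x y f1 d1)|/(IH2 i x y f2 d2)].
- by case/andP=> f1 f2; rewrite geq_max => /andP[d1 _] [/(IH1 i x y f1 d1)].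
- case/andP=> f1 f2; case: i => // i; rewrite ltnS geq_max => /andP[d1 d2].
  by case=> v [/(IH1 i x v f1 d1) Hxv /(IH2 i v y f2 d2)]; apply: pathsF_comp.
- by case/and3P=> _ f1 f2; rewrite geq_max => /andP[d1 _] [/(IH1 i x y f1 d1)].
- case/and3P=> H _ _; case: i => // i _ _.
  by apply: pathsF_res; rewrite ?H.
- case/and3P=> H _ _; case: i => // i _ _.
  by apply: pathsF_res; rewrite ?H ?orbT.
- by case/andP=> H1 _ _ _; apply: pathsF_at0; rewrite /one_at0 H1 !orbT.
- by case/andP=> H1 f1 d1 /(IH1 i y x f1 d1); apply: pathsF_sym.
- by move=> _ _ [-> _]; apply: pathsF_refl.
- by move=> _ _ [-> _]; apply: pathsF_refl.
- by move=> _ _ [-> _]; apply: pathsF_refl.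
- by move=> _ _ [-> _]; apply: pathsF_refl.
Qed.

(** * Bisimilar nodes satisfy the same expressions *)

(* Closing each level under simultaneous converse lets the induction on
   expressions treat converse as an ordinary operation. *)
Definition conv_closure (F : {pred feature}) (L : finType)
    (G1 G2 : structure L) (Z : quaternary G1 G2) : quaternary G1 G2 :=
  fun a1 b1 a2 b2 => Z a1 b1 a2 b2 \/ FConv \in F /\ Z b1 a1 b2 a2.

(** This swaps the two structures, not the two nodes of a pair; it exchanges Forth and Back
    clauses. *)
Definition converse_quaternary (L : finType) (G1 G2 : structure L)
    (Z : quaternary G1 G2) : quaternary G2 G1 :=
  fun a2 b2 a1 b1 => Z a1 b1 a2 b2.

Lemma bisimulation_sym (L : finType) (F : {pred feature}) k
  (G1 G2 : structure L) (Z : nat -> quaternary G1 G2) :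
  bisimulation F k Z -> bisimulation F k (fun i => converse_quaternary (Z i)).
Proof.
case=> sub0 at0 stepZ; split.
- by move=> i lt_ik a2 b2 a1 b1; apply: sub0.
- by move=> a2 b2 a1 b1 /at0 [? ?].
move=> i lt_ik a2 b2 a1 b1 /(stepZ i lt_ik)[[cf cb] Hp Hl Hr].
by split=> [|/Hp[? ?]|/Hl[? ?]|/Hr[? ?]]; split.
Qed.

Lemma bisimulation_sub (L : finType) (F : {pred feature}) k
  (G1 G2 : structure L) (Z : nat -> quaternary G1 G2) i j a1 b1 a2 b2 :
  bisimulation F k Z -> i <= j -> j <= k -> Z j a1 b1 a2 b2 -> Z i a1 b1 a2 b2.
Proof.
case=> sub0 _ _ le_ij; rewrite -(subnK le_ij).
elim: (j - i) => [//|m IHm] le_k /sub0 HZ.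
by apply: IHm; [apply: ltnW | apply: HZ].
Qed.

Lemma conv_closure_flip (L : finType) (F : {pred feature})
  (G1 G2 : structure L) (Z : quaternary G1 G2) a1 b1 a2 b2 :
  FConv \in F -> conv_closure F Z a1 b1 a2 b2 -> conv_closure F Z b1 a1 b2 a2.
Proof. by move=> cF [|[_]] H; [right | left]. Qed.

Lemma bisim_atom (L : finType) (F : {pred feature}) k
  (G1 G2 : structure L) (Z : nat -> quaternary G1 G2) i a1 b1 a2 b2 e :
  bisimulation F k Z -> i <= k -> Z i a1 b1 a2 b2 ->
  atomic e -> in_fragment F e -> eval e a1 b1 -> eval e a2 b2.
Proof.
move=> bZ le_ik /(bisimulation_sub bZ (leq0n i) le_ik) HZ ate fe ev.
by case: bZ => _ /(_ _ _ _ _ HZ) [forth _] _; case: (forth e).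
Qed.

Lemma bisim_eq (L : finType) (F : {pred feature}) k
  (G1 G2 : structure L) (Z : nat -> quaternary G1 G2) i a1 b1 a2 b2 :
  bisimulation F k Z -> i <= k -> Z i a1 b1 a2 b2 -> a1 = b1 -> a2 = b2.
Proof.
by move=> bZ le_ik HZ; apply: (bisim_atom (e := EId) bZ le_ik HZ).
Qed.

(** A diagonal pair is its own converse, and [1'] is an atom, so [conv_closure] adds nothing
    here. *)
Lemma bisim_diag (L : finType) (F : {pred feature}) k
  (G1 G2 : structure L) (Z : nat -> quaternary G1 G2) i a1 a2 b2 :
  bisimulation (saturate F) k Z -> i <= k ->
  conv_closure F (Z i) a1 a1 a2 b2 -> a2 = b2 /\ Z i a1 a1 a2 a2.
Proof.
by move=> bZ le_ik [|[_]] HZ; have eq2 := bisim_eq bZ le_ik HZ (erefl a1);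
  move: HZ; rewrite eq2.
Qed.

(** Coprojections have no clause of their own. Either the projection clause is available after
    saturation, or another clause at the diagonal pair yields the same witnesses. *)
Lemma bisim_proj (L : finType) (F : {pred feature}) k
  (G1 G2 : structure L) (Z : nat -> quaternary G1 G2) i a1 a2 :
  (FProj \in F) || (FCoproj \in F) -> bisimulation (saturate F) k Z ->
  i < k -> Z i.+1 a1 a1 a2 a2 ->
  (forall c1, pathsF F i a1 c1 -> exists c2, Z i a1 c1 a2 c2) /\
  (forall c1, pathsF F i c1 a1 -> exists c2, Z i c1 a1 c2 a2).
Proof.
move=> pF [_ _ stepZ] lt_ik /(stepZ i lt_ik)[[cf _] Hp Hl Hr].
have [/Hp[[[//|[_ _ pf1]] pf2] _]|pNF] := boolP (FProj \in saturate F).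
  by split=> c1 Hc1; [apply: pf1 | apply: pf2]; rewrite ?pathsF_saturate.
(* With a symmetric path relation, the round trip from [a1] to [c1] and back is an instance of
   Composition Forth. *)
have [sym|nsym] := boolP (one_at0 F || (FConv \in F)).
  have symP c1 c1' : pathsF F i c1 c1' -> pathsF F i c1' c1.
    case/orP: sym => [F1 _|]; first exact: pathsF_at0.
    by move=> cF; apply: pathsF_sym.
  split=> c1 Hc1; have /(_ c1)[||c2 [? ?]] := cf; rewrite ?pathsF_saturate //;
    by [exact: symP | exists c2].
(* Otherwise [needs_proj] would have added projection. The two residual Back clauses at a diagonal
   pair supply the outgoing and the incoming witness. *)
have [lF rF] : FLres \in F /\ FRres \in F.
  apply/andP; apply: contraR pNF => nlr; rewrite in_saturate /needs_proj nlr.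
  by move: nsym pF; rewrite negb_or => /andP[-> ->] /orP[]->; rewrite ?orbT.
split=> c1 Hc1.
  have [_ /(_ c1)[|c2 [? _]]] := Hl (sub_saturate lF);
    by rewrite ?pathsF_saturate //; exists c2.
have [_ /(_ c1)[|c2 [? _]]] := Hr (sub_saturate rF);
  by rewrite ?pathsF_saturate //; exists c2.
Qed.

Lemma bisim_comp (L : finType) (F : {pred feature}) k
  (G1 G2 : structure L) (Z : nat -> quaternary G1 G2) i a1 b1 a2 b2 c1 :
  bisimulation (saturate F) k Z -> i < k ->
  conv_closure F (Z i.+1) a1 b1 a2 b2 ->
  pathsF F i a1 c1 -> pathsF F i c1 b1 ->
  exists c2, conv_closure F (Z i) a1 c1 a2 c2 /\
             conv_closure F (Z i) c1 b1 c2 b2.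
Proof.
case=> _ _ stepZ lt_ik [|[cF]] /(stepZ i lt_ik)[[cf _] _ _ _] Hac Hcb.
  have [||c2 [? ?]] := cf c1; rewrite ?pathsF_saturate //.
  by exists c2; split; left.
have [||c2 [? ?]] := cf c1; rewrite ?pathsF_saturate; try exact: pathsF_sym.
by exists c2; split; right.
Qed.

Lemma saturate_res (F : {pred feature}) :
  ~~ one_at0 F -> FConv \in F -> (FLres \in F) || (FRres \in F) ->
  FLres \in saturate F /\ FRres \in saturate F.
Proof. by rewrite !in_saturate /needs_res => -> -> ->; rewrite !orbT. Qed.

(** For a reversed pair, converse turns the left residual clause into the right residual clause of
    the pair stored in [Z]. *)
Lemma bisim_lres (L : finType) (F : {pred feature}) k
  (G1 G2 : structure L) (Z : nat -> quaternary G1 G2) i a1 b1 a2 b2 c2 :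
  FLres \in F -> bisimulation (saturate F) k Z -> i < k ->
  conv_closure F (Z i.+1) a1 b1 a2 b2 -> pathsF F i b2 c2 ->
  exists c1, conv_closure F (Z i) b1 c1 b2 c2 /\
    (pathsF F i a1 c1 -> conv_closure F (Z i) a1 c1 a2 c2).
Proof.
move=> lF bZ lt_ik [|[cF]] HZ Hc2; have [_ _ /(_ i lt_ik _ _ _ _ HZ)] := bZ.
  case=> _ _ /(_ (sub_saturate lF))[/(_ c2) lf _] _.
  case: lf => [|c1 [H1 H2]]; first by rewrite pathsF_saturate.
  exists c1; split; first by left.
  by rewrite pathsF_saturate in H2; case: H2 => // ? _; left.
case=> [[_ cb] _ _ Hr]; have [F1|nF1] := boolP (one_at0 F).
  (* With 1 at degree 0 every node meets the path premises, so Composition Back already gives a node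
     matching on both sides. *)
  have [||c1 [H1 H2]] := cb c2; try by rewrite pathsF_saturate; apply: pathsF_at0.
  by exists c1; split=> [|_]; [left | right].
(* Without 1 at degree 0, saturation has put both residuals in, so the right one can be used. *)
have [_ /Hr[/(_ c2) rf _]] := saturate_res nF1 cF (introT orP (or_introl lF)).
case: rf => [|c1 [H1 H2]].
  by rewrite pathsF_saturate; apply: pathsF_sym.
exists c1; split; first by right.
rewrite pathsF_saturate in H2; move/(pathsF_sym cF) => Hac.
by case: H2 => // ?; right.
Qed.

Lemma bisim_rres (L : finType) (F : {pred feature}) k
  (G1 G2 : structure L) (Z : nat -> quaternary G1 G2) i a1 b1 a2 b2 c2 :
  FRres \in F -> bisimulation (saturate F) k Z -> i < k ->
  conv_closure F (Z i.+1) a1 b1 a2 b2 -> pathsF F i c2 a2 ->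
  exists c1, conv_closure F (Z i) c1 a1 c2 a2 /\
    (pathsF F i c1 b1 -> conv_closure F (Z i) c1 b1 c2 b2).
Proof.
move=> rF bZ lt_ik [|[cF]] HZ Hc2; have [_ _ /(_ i lt_ik _ _ _ _ HZ)] := bZ.
  case=> _ _ _ /(_ (sub_saturate rF))[/(_ c2) rf _].
  case: rf => [|c1 [H1 H2]]; first by rewrite pathsF_saturate.
  exists c1; split; first by left.
  by rewrite pathsF_saturate in H2; case: H2 => // ? _; left.
case=> [[_ cb] _ Hl _]; have [F1|nF1] := boolP (one_at0 F).
  have [||c1 [H1 H2]] := cb c2; try by rewrite pathsF_saturate; apply: pathsF_at0.
  by exists c1; split=> [|_]; [left | right].
have [/Hl[/(_ c2) lf _] _] := saturate_res nF1 cF (introT orP (or_intror rF)).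
case: lf => [|c1 [H1 H2]].
  by rewrite pathsF_saturate; apply: pathsF_sym.
exists c1; split; first by right.
rewrite pathsF_saturate in H2; move/(pathsF_sym cF) => Hac.
by case: H2 => // ?; right.
Qed.

(** The structures and [Z] are quantified after [e], so that for arguments in negative position
    (difference, complement, residual, coprojection) the induction hypothesis applies to the swapped
    bisimulation. Witnesses qualify for the clauses by [eval_pathsF]. *)
Lemma bisim_eval (L : finType) (F : {pred feature}) k (e : expr L) :
  in_fragment F e ->
  forall (G1 G2 : structure L) (Z : nat -> quaternary G1 G2) i a1 b1 a2 b2,
  bisimulation (saturate F) k Z -> degree e <= i -> i <= k ->
  conv_closure F (Z i) a1 b1 a2 b2 -> eval e a1 b1 -> eval e a2 b2.
Proof.
elim: e => [R||||| e1 IH1 e2 IH2|e1 IH1 e2 IH2|e1 IH1 e2 IH2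
  |e1 IH1 e2 IH2|e1 IH1 e2 IH2|e1 IH1 e2 IH2|e1 IH1|e1 IH1|e1 IH1|e1 IH1
  |e1 IH1|e1 IH1] /=.
- move=> _ G1 G2 Z i a1 b1 a2 b2 bZ _ le_ik [|[cF]] HZ.
    exact: (bisim_atom (e := ERel R) bZ le_ik HZ).
  (* On a reversed pair the relation name is read as the atom [R^{-1}], which is in the fragment
     because converse is. *)
  by apply: (bisim_atom (e := EConv (ERel R)) bZ le_ik HZ);
    rewrite //= sub_saturate.
- by [].
- by [].
- move=> dF G1 G2 Z i a1 b1 a2 b2 /bisimulation_sym bZ _ le_ik [|[cF]] HZ.
    by apply: contra_not; apply: (bisim_eq bZ le_ik HZ).
  by apply: contra_not => ?; apply/esym/(bisim_eq bZ le_ik HZ).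
- move=> _ G1 G2 Z i a1 b1 a2 b2 bZ _ le_ik [|[cF]] HZ.
    exact: (bisim_eq bZ le_ik HZ).
  by move=> ?; apply/esym/(bisim_eq bZ le_ik HZ).
- case/andP=> f1 f2 G1 G2 Z i a1 b1 a2 b2 bZ; rewrite geq_max.
  case/andP=> d1 d2 le_ik HZ [ev|ev]; [left | right].
    exact: (IH1 f1 _ _ _ _ _ _ _ _ bZ d1 le_ik HZ).
  exact: (IH2 f2 _ _ _ _ _ _ _ _ bZ d2 le_ik HZ).
- case/andP=> f1 f2 G1 G2 Z i a1 b1 a2 b2 bZ; rewrite geq_max.
  case/andP=> d1 d2 le_ik HZ [ev1 ev2]; split.
    exact: (IH1 f1 _ _ _ _ _ _ _ _ bZ d1 le_ik HZ).
  exact: (IH2 f2 _ _ _ _ _ _ _ _ bZ d2 le_ik HZ).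
- case/andP=> f1 f2 G1 G2 Z [|i] a1 b1 a2 b2 bZ //; rewrite ltnS geq_max.
  case/andP=> d1 d2 lt_ik HZ [c1 [ev1 ev2]].
  have [c2 [HZ1 HZ2]] := bisim_comp bZ lt_ik HZ (eval_pathsF f1 d1 ev1)
    (eval_pathsF f2 d2 ev2).
  exists c2; split.
    exact: (IH1 f1 _ _ _ _ _ _ _ _ bZ d1 (ltnW lt_ik) HZ1).
  exact: (IH2 f2 _ _ _ _ _ _ _ _ bZ d2 (ltnW lt_ik) HZ2).
- case/and3P=> _ f1 f2 G1 G2 Z i a1 b1 a2 b2 bZ; rewrite geq_max.
  case/andP=> d1 d2 le_ik HZ [ev1 nev2]; split.
    exact: (IH1 f1 _ _ _ _ _ _ _ _ bZ d1 le_ik HZ).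
  apply: contra_not nev2.
  exact: (IH2 f2 _ _ _ _ _ _ _ _ (bisimulation_sym bZ) d2 le_ik HZ).
- case/and3P=> lF f1 f2 G1 G2 Z [|i] a1 b1 a2 b2 bZ //; rewrite ltnS geq_max.
  case/andP=> d1 d2 lt_ik HZ ev c2 ev2.
  have [c1 [HZ1 HZ2]] := bisim_lres lF bZ lt_ik HZ (eval_pathsF f2 d2 ev2).
  have {}ev : eval e1 a1 c1.
    apply: ev; apply: (IH2 f2 _ _ _ _ _ _ _ _ _ d2 (ltnW lt_ik) _ ev2).
      exact: (bisimulation_sym bZ).
    exact: HZ1.
  apply: (IH1 f1 _ _ _ _ _ _ _ _ bZ d1 (ltnW lt_ik) _ ev).
  (* Since [e1] holds at [(a1, c1)], this pair is path-related, which rules out the escape disjunct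
     of the residual clause. *)
  exact/HZ2/(eval_pathsF f1 d1 ev).
- case/and3P=> rF f1 f2 G1 G2 Z [|i] a1 b1 a2 b2 bZ //; rewrite ltnS geq_max.
  case/andP=> d1 d2 lt_ik HZ ev c2 ev1.
  have [c1 [HZ1 HZ2]] := bisim_rres rF bZ lt_ik HZ (eval_pathsF f1 d1 ev1).
  have {}ev : eval e2 c1 b1.
    apply: ev; apply: (IH1 f1 _ _ _ _ _ _ _ _ _ d1 (ltnW lt_ik) _ ev1).
      exact: (bisimulation_sym bZ).
    exact: HZ1.
  apply: (IH2 f2 _ _ _ _ _ _ _ _ bZ d2 (ltnW lt_ik) _ ev).
  exact/HZ2/(eval_pathsF f2 d2 ev).
- case/andP=> _ f1 G1 G2 Z i a1 b1 a2 b2 bZ d1 le_ik HZ; apply: contra_not.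
  exact: (IH1 f1 _ _ _ _ _ _ _ _ (bisimulation_sym bZ) d1 le_ik HZ).
- case/andP=> cF f1 G1 G2 Z i a1 b1 a2 b2 bZ d1 le_ik HZ.
  exact: (IH1 f1 _ _ _ _ _ _ _ _ bZ d1 le_ik (conv_closure_flip cF HZ)).
- case/andP=> pF f1 G1 G2 Z [|i] a1 b1 a2 b2 bZ // d1 lt_ik HZ [eq1 [c1 ev]].
  move: HZ; rewrite -eq1 => /(bisim_diag bZ lt_ik) [<- HZ]; split=> //.
  have pcF : (FProj \in F) || (FCoproj \in F) by rewrite pF.
  have [/(_ c1 (eval_pathsF f1 d1 ev))[c2 HZ2] _] :=
    bisim_proj pcF bZ lt_ik HZ.
  exists c2.
  exact: (IH1 f1 _ _ _ _ _ _ _ _ bZ d1 (ltnW lt_ik) (or_introl HZ2) ev).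
- case/andP=> pF f1 G1 G2 Z [|i] a1 b1 a2 b2 bZ // d1 lt_ik HZ [eq1 [c1 ev]].
  move: HZ; rewrite -eq1 => /(bisim_diag bZ lt_ik) [<- HZ]; split=> //.
  have pcF : (FProj \in F) || (FCoproj \in F) by rewrite pF.
  have [_ /(_ c1 (eval_pathsF f1 d1 ev))[c2 HZ2]] :=
    bisim_proj pcF bZ lt_ik HZ.
  exists c2.
  exact: (IH1 f1 _ _ _ _ _ _ _ _ bZ d1 (ltnW lt_ik) (or_introl HZ2) ev).
- case/andP=> pF f1 G1 G2 Z [|i] a1 b1 a2 b2 bZ // d1 lt_ik HZ [eq1 nev].
  move: HZ; rewrite -eq1 => /(bisim_diag bZ lt_ik) [<- HZ]; split=> //.
  apply: contra_not nev => -[c1 ev]; have bZ' := bisimulation_sym bZ.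
  have pcF : (FProj \in F) || (FCoproj \in F) by rewrite pF orbT.
  have [/(_ c1 (eval_pathsF f1 d1 ev))[c2 HZ2] _] :=
    bisim_proj pcF bZ' lt_ik HZ.
  exists c2.
  exact: (IH1 f1 _ _ _ _ _ _ _ _ bZ' d1 (ltnW lt_ik) (or_introl HZ2) ev).
- case/andP=> pF f1 G1 G2 Z [|i] a1 b1 a2 b2 bZ // d1 lt_ik HZ [eq1 nev].
  move: HZ; rewrite -eq1 => /(bisim_diag bZ lt_ik) [<- HZ]; split=> //.
  apply: contra_not nev => -[c1 ev]; have bZ' := bisimulation_sym bZ.
  have pcF : (FProj \in F) || (FCoproj \in F) by rewrite pF orbT.
  have [_ /(_ c1 (eval_pathsF f1 d1 ev))[c2 HZ2]] :=
    bisim_proj pcF bZ' lt_ik HZ.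
  exists c2.
  exact: (IH1 f1 _ _ _ _ _ _ _ _ bZ' d1 (ltnW lt_ik) (or_introl HZ2) ev).
Qed.

Lemma bisimilar_equiv (L : finType) (F : {pred feature}) k (M1 M2 : marked L) :
  bisimilar (saturate F) k M1 M2 -> equiv_upto F k M1 M2.
Proof.
case=> Z bZ HZ e fe de; split.
  exact: (bisim_eval fe bZ de (leqnn k) (or_introl HZ)).
exact: (bisim_eval fe (bisimulation_sym bZ) de (leqnn k) (or_introl HZ)).
Qed.

(** * Derived operations *)

Definition frag (L : finType) (F : {pred feature}) (i : nat) (e : expr L) :=
  in_fragment F e && (degree e <= i).

Definition ediff (L : finType) (F : {pred feature}) (e1 e2 : expr L) :=
  if FDiff \in F then EDiff e1 e2 else EInter e1 (ECompl e2).

Lemma eval_ediff (L : finType) F (e1 e2 : expr L) (G : structure L)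
  (a b : node G) :
  eval (ediff F e1 e2) a b <-> eval e1 a b /\ ~ eval e2 a b.
Proof. by rewrite /ediff; case: ifP. Qed.

Lemma frag_ediff (L : finType) (F : {pred feature}) i (e1 e2 : expr L) :
  (FCompl \in F) || (FDiff \in F) ->
  frag F i e1 -> frag F i e2 -> frag F i (ediff F e1 e2).
Proof.
rewrite /frag /ediff orbC => HF /andP[f1 d1] /andP[f2 d2]; move: HF.
by case: ifP => /= [->|_ ->]; rewrite f1 f2 geq_max d1 d2.
Qed.

Definition eproj1 (L : finType) (F : {pred feature}) (e : expr L) :=
  if FProj \in F then EProj1 e else EDiff EId (ECoproj1 e).

Definition eproj2 (L : finType) (F : {pred feature}) (e : expr L) :=
  if FProj \in F then EProj2 e else EDiff EId (ECoproj2 e).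

Lemma eval_eproj1 (L : finType) F (e : expr L) (G : structure L)
  (a b : node G) :
  eval (eproj1 F e) a b <-> a = b /\ exists c, eval e a c.
Proof.
rewrite /eproj1; case: ifP => //= _; split=> [[-> nn]|[-> ex]]; last first.
  by split=> // -[].
by split=> //; apply: contrapT => nex; apply: nn.
Qed.

Lemma eval_eproj2 (L : finType) F (e : expr L) (G : structure L)
  (a b : node G) :
  eval (eproj2 F e) a b <-> a = b /\ exists c, eval e c a.
Proof.
rewrite /eproj2; case: ifP => //= _; split=> [[-> nn]|[-> ex]]; last first.
  by split=> // -[].
by split=> //; apply: contrapT => nex; apply: nn.
Qed.

(** If projection comes only from saturation, [needs_proj] provides coprojection and excludes
    complement; the hypothesis then leaves difference, as [1'] minus a coprojection requires. *)
Lemma frag_eproj (L : finType) (F : {pred feature}) i (e : expr L) :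
  (FCompl \in F) || (FDiff \in F) -> FProj \in saturate F -> frag F i e ->
  frag F i.+1 (eproj1 F e) /\ frag F i.+1 (eproj2 F e).
Proof.
rewrite in_saturate /needs_proj /one_at0 /frag /eproj1 /eproj2.
move=> HF pF /andP[fe de]; move: HF pF.
case: ifP => [pF _ _|_] /=; first by rewrite pF fe !ltnS de.
rewrite !negb_or => HF /and4P[/and3P[_ _ nC] cpF _ _].
by move: HF; rewrite (negbTE nC) cpF fe max0n !ltnS de /= => ->.
Qed.

Definition elres (L : finType) (F : {pred feature}) (e1 e2 : expr L) :=
  if FLres \in F then ELres e1 e2 else EConv (ERres (EConv e2) (EConv e1)).

Definition erres (L : finType) (F : {pred feature}) (e1 e2 : expr L) :=
  if FRres \in F then ERres e1 e2 else EConv (ELres (EConv e2) (EConv e1)).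

Lemma eval_elres (L : finType) F (e1 e2 : expr L) (G : structure L)
  (a b : node G) :
  eval (elres F e1 e2) a b <-> forall c, eval e2 b c -> eval e1 a c.
Proof. by rewrite /elres; case: ifP. Qed.

Lemma eval_erres (L : finType) F (e1 e2 : expr L) (G : structure L)
  (a b : node G) :
  eval (erres F e1 e2) a b <-> forall c, eval e1 c a -> eval e2 c b.
Proof. by rewrite /erres; case: ifP. Qed.

(** If [/] comes only from saturation, then converse and [\] belong to [F]; the converses do not
    raise the degree. *)
Lemma frag_elres (L : finType) (F : {pred feature}) i (e1 e2 : expr L) :
  FLres \in saturate F -> frag F i e1 -> frag F i e2 ->
  frag F i.+1 (elres F e1 e2).
Proof.
rewrite in_saturate /needs_res /frag /elres => lF /andP[f1 d1] /andP[f2 d2].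
move: lF; case: ifP => /= [-> _|_ /and3P[_ -> ->]];
  by rewrite f1 f2 ltnS geq_max ?d1 d2.
Qed.

Lemma frag_erres (L : finType) (F : {pred feature}) i (e1 e2 : expr L) :
  FRres \in saturate F -> frag F i e1 -> frag F i e2 ->
  frag F i.+1 (erres F e1 e2).
Proof.
rewrite in_saturate /needs_res /frag /erres => lF /andP[f1 d1] /andP[f2 d2].
move: lF; case: ifP => /= [-> _|_ /and3P[_ ->]]; last rewrite orbF => ->;
  by rewrite f1 f2 ltnS geq_max ?d1 d2.
Qed.

(** * Expressions for the path relations *)

Definition eunion (L : finType) (s : seq (expr L)) : expr L :=
  foldr (@EUnion L) EZero s.

Lemma eval_eunion (L : finType) (s : seq (expr L)) (G : structure L)
  (a b : node G) :
  eval (eunion s) a b <-> exists2 e, e \in s & eval e a b.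
Proof.
elim: s => [|e s IHs] /=; first by split=> // -[].
split=> [[ev|/IHs[f sf ev]]|[f + ev]].
- by exists e; rewrite ?mem_head.
- by exists f; rewrite // in_cons sf orbT.
- by rewrite in_cons => /predU1P[<-|sf]; [left | right; apply/IHs; exists f].
Qed.

Lemma frag_eunion (L : finType) (F : {pred feature}) i (s : seq (expr L)) :
  all (frag F i) s -> frag F i (eunion s).
Proof.
elim: s => //= e s IHs /andP[/andP[fe de] /IHs/andP[fs ds]].
by rewrite /frag /= fe fs geq_max de ds.
Qed.

(** Intended for [one_at0 F] only: then one of the three forms lies in the fragment, at degree 0. *)
Definition eone (L : finType) (F : {pred feature}) : expr L :=
  if FOne \in F then EOne else
  if FDiv \in F then EUnion EDiv EId else ECompl EZero.

(** The union of this list expresses walks of length at most [2 ^ 0]; [EId] stands for length 0.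
    Finiteness of [L] makes it an expression. *)
Definition step_exprs (L : finType) (F : {pred feature}) : seq (expr L) :=
  EId :: [seq ERel R | R <- enum L] ++
  (if FConv \in F then [seq EConv (ERel R) | R <- enum L] else [::]).

Fixpoint walk_expr (L : finType) (F : {pred feature}) (i : nat) : expr L :=
  if i is j.+1 then EComp (walk_expr L F j) (walk_expr L F j)
  else eunion (step_exprs L F).

Definition path_expr (L : finType) (F : {pred feature}) (i : nat) : expr L :=
  if one_at0 F then eone L F
  else if one_at1 F && (0 < i) then
    (* Residuals of [0] by [0] hold vacuously everywhere. Their degree is 1, which [0 < i]
       permits. *)
    if FLres \in F then ELres EZero EZero else ERres EZero EZero
  else walk_expr L F i.

Lemma eval_step_exprs (L : finType) (F : {pred feature}) (G : structure L)
  (a b : node G) :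
  eval (eunion (step_exprs L F)) a b <->
  (if FConv \in F then upaths 0 a b else paths 0 a b).
Proof.
rewrite eval_eunion.
suff -> : (if FConv \in F then upaths 0 a b else paths 0 a b) <->
    a = b \/ (Defs.arc a b \/ FConv \in F /\ Defs.arc b a).
  split=> [[e]|].
    rewrite in_cons mem_cat => /predU1P[-> /= ->|/orP[]]; first by left.
      by case/mapP=> R _ -> Rab; right; left; exists R.
    case: ifP => // cF /mapP[R _ ->] Rba.
    by right; right; split=> //; exists R.
  case=> [->|[[R Rab]|[cF [R Rba]]]].
  - by exists EId; rewrite // mem_head.
  - exists (ERel R) => //.
    by rewrite in_cons mem_cat map_f ?mem_enum ?orbT.
  - exists (EConv (ERel R)) => //.
    by rewrite in_cons mem_cat cF (map_f (fun R => EConv (ERel R))) ?mem_enum ?orbT.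
by case: ifP => cF; apply: iff_trans (bounded_walk0 _ _ _) _; intuition.
Qed.

Lemma eval_walk_expr (L : finType) (F : {pred feature}) i (G : structure L)
  (a b : node G) :
  eval (walk_expr L F i) a b <->
  (if FConv \in F then upaths i a b else paths i a b).
Proof.
elim: i a b => [|i IHi] a b; first exact: eval_step_exprs.
have -> : (if FConv \in F then upaths i.+1 a b else paths i.+1 a b) <->
   exists c, (if FConv \in F then upaths i a c else paths i a c) /\
             (if FConv \in F then upaths i c b else paths i c b).
  by case: ifP => _; apply: bounded_walkS.
by split=> -[c [/IHi ? /IHi ?]]; exists c.
Qed.

Lemma eval_path_expr (L : finType) (F : {pred feature}) i (G : structure L)
  (a b : node G) :
  eval (path_expr L F i) a b <-> pathsF F i a b.
Proof.
rewrite /path_expr /pathsF; case n0: (one_at0 F) => /=.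
  split=> // _; rewrite /eone; case: ifP => // _; case: ifP => [_|_ []].
  by case: (EM (a = b)); [right | left].
by case: ifP => _; last exact: eval_walk_expr; case: ifP => _; split=> // _ ?.
Qed.

Lemma frag_path_expr (L : finType) (F : {pred feature}) i :
  frag F i (path_expr L F i).
Proof.
rewrite /path_expr; case: ifP => [|_].
  rewrite /one_at0 /eone /frag; case: ifP => [/= ->//|_].
  by case: ifP => /= [->|_ ->].
case: ifP => [/andP[/andP[_ rF] i0]|_].
  rewrite /frag; case: ifP => /= [->|nF]; first exact: i0.
  by move: rF; rewrite nF /= => ->.
elim: i => [|i /andP[fi di]]; last first.
  by rewrite /frag /= fi maxnn ltnS di.
apply: frag_eunion; apply/allP=> e.
rewrite in_cons mem_cat => /predU1P[->//|/orP[/mapP[R _ ->]//|]].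
by case: ifP => // cF /mapP[R _ ->]; rewrite /frag /= cF.
Qed.

(** * Characteristic expressions *)

Definition agree (L : finType) (B : seq (expr L)) (G1 G2 : structure L) :
    quaternary G1 G2 :=
  fun a1 b1 a2 b2 => forall e, e \in B -> (eval e a1 b1 <-> eval e a2 b2).

Arguments agree {L} B {G1 G2} _ _ _ _.

Lemma agree_refl (L : finType) (B : seq (expr L)) (G : structure L)
  (a b : node G) : agree B a b a b.
Proof. by []. Qed.

Lemma agree_sym (L : finType) (B : seq (expr L)) (G1 G2 : structure L)
  (a1 b1 : node G1) (a2 b2 : node G2) :
  agree B a1 b1 a2 b2 -> agree B a2 b2 a1 b1.
Proof. by move=> H e Be; split=> /(H e Be). Qed.

(** All ways of imposing each member of [B] or its negation on [p]. Starting from [p] instead of 1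
    keeps the negations relative, so that difference alone can express them. *)
Fixpoint chars (L : finType) (F : {pred feature}) (p : expr L)
    (B : seq (expr L)) : seq (expr L) :=
  if B is e :: B' then
    [seq EInter x e | x <- chars F p B'] ++ [seq ediff F x e | x <- chars F p B']
  else [:: p].

(** For each member of [B], take the conjunct true at [(a, b)]. The resulting [x] is one expression
    for all structures, which lets it carry a class from one structure to the other. *)
Lemma charsP (L : finType) (F : {pred feature}) (p : expr L)
  (B : seq (expr L)) (G : structure L) (a b : node G) :
  eval p a b ->
  exists2 x, x \in chars F p B & forall (G' : structure L) (c d : node G'),
    eval x c d <-> eval p c d /\ agree B a b c d.
Proof.
move=> pab; elim: B => [|e B [x xC xP]] /=.
  by exists p; rewrite ?mem_head // => G' c d; split=> [? |[]].
have agree_cons (G' : structure L) (c d : node G') :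
    agree (e :: B) a b c d <->
    (eval e a b <-> eval e c d) /\ agree B a b c d.
  split=> [H|[He HB] f]; last by rewrite in_cons => /predU1P[->|/HB].
  by split=> [|f Bf]; apply: H; rewrite ?mem_head // in_cons Bf orbT.
have [ev|nev] := EM (eval e a b).
  exists (EInter x e) => [|G' c d /=].
    by rewrite mem_cat (map_f (fun x => EInter x e)).
  by rewrite xP agree_cons; intuition.
exists (ediff F x e) => [|G' c d].
  by rewrite mem_cat (map_f (fun x => ediff F x e)) ?orbT.
by rewrite eval_ediff xP agree_cons; intuition.
Qed.

Lemma frag_chars (L : finType) (F : {pred feature}) i (p : expr L)
  (B : seq (expr L)) :
  (FCompl \in F) || (FDiff \in F) -> frag F i p -> all (frag F i) B ->
  all (frag F i) (chars F p B).
Proof.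
move=> HF fp; elim: B => [|e B IHB] /=; first by rewrite fp.
case/andP=> fe /IHB/allP fB; apply/allP=> x; rewrite mem_cat.
case/orP=> /mapP[y /fB fy ->]; last exact: frag_ediff.
by move: fe fy; rewrite /frag /= geq_max => /andP[-> ->] /andP[-> ->].
Qed.

(** In both residuals the implied position ranges over [D]: complements within [p] of the classes,
    and [p] itself to exclude pairs that are not path-related. Candidates may fall outside the
    fragment; [basis] filters them. *)
Definition candidates (L : finType) (F : {pred feature}) (p : expr L)
    (C : seq (expr L)) : seq (expr L) :=
  let D := p :: [seq ediff F p x | x <- C] in
  [seq EComp x y | x <- C, y <- C] ++
  [seq eproj1 F x | x <- C] ++ [seq eproj2 F x | x <- C] ++
  [seq elres F x y | x <- D, y <- C] ++ [seq erres F y x | x <- D, y <- C].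

Definition atoms (L : finType) : seq (expr L) :=
  EId :: EDiv ::
  [seq ERel R | R <- enum L] ++ [seq EConv (ERel R) | R <- enum L].

Definition char_exprs (L : finType) (F : {pred feature}) i
    (B : seq (expr L)) : seq (expr L) :=
  chars F (path_expr L F i) B.

(** Cumulative in [i], so that agreement gets finer with the degree, as the inclusions between the
    levels of a bisimulation demand. *)
Fixpoint basis (L : finType) (F : {pred feature}) (i : nat) : seq (expr L) :=
  if i is j.+1 then
    basis L F j ++ filter (frag F i)
      (candidates F (path_expr L F j) (char_exprs F j (basis L F j)))
  else filter (frag F 0) (atoms L).

Lemma frag_basis (L : finType) (F : {pred feature}) i :
  all (frag F i) (basis L F i).
Proof.
elim: i => [|i IHi]; first exact: filter_all.
rewrite all_cat filter_all andbT; apply: sub_all IHi => e.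
by rewrite /frag => /andP[-> /leqW].
Qed.

(** Saturation affects neither [0'] nor converse, so it creates no new atomic expression. *)
Lemma agree_atoms (L : finType) (F : {pred feature}) (G1 G2 : structure L)
  (a1 b1 : node G1) (a2 b2 : node G2) :
  agree (basis L F 0) a1 b1 a2 b2 -> atoms_forth (saturate F) a1 b1 a2 b2.
Proof.
move=> H e [ate fe ev]; split=> //; have [|+ _] := H e; last exact.
rewrite mem_filter.
case: e {ev} ate fe => // [R|||e] //=; rewrite /frag /=.
- by rewrite !in_cons mem_cat map_f ?mem_enum ?orbT.
- by rewrite in_saturate orbF => _ ->; rewrite !in_cons eqxx orbT.
- by rewrite in_cons eqxx.
case: e => //= R _; rewrite in_saturate orbF => ->.
by rewrite !in_cons mem_cat (map_f (fun R => EConv (ERel R))) ?mem_enum ?orbT.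
Qed.

(** * Forth clauses for agreement on a basis *)

Section AgreeClauses.

Variables (L : finType) (F : {pred feature}) (i : nat).
Hypothesis HF : (FCompl \in F) || (FDiff \in F).
Variables (G1 G2 : structure L) (a1 b1 : node G1) (a2 b2 : node G2).
Hypothesis Hagree : agree (basis L F i.+1) a1 b1 a2 b2.

Let B := basis L F i.
Let p := path_expr L F i.
Let C := char_exprs F i B.

Lemma char_exprP (G : structure L) (a b : node G) :
  pathsF F i a b ->
  exists x, [/\ x \in C, frag F i x, eval x a b
    & forall (G' : structure L) (c d : node G'),
      eval x c d <-> pathsF F i c d /\ agree B a b c d].
Proof.
move=> Pab; have [|x xC xP] := @charsP L F p B G a b.
  exact/eval_path_expr.
exists x; split=> //.
- have /allP := frag_chars HF (frag_path_expr L F i) (frag_basis L F i).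
  exact.
- by apply/xP; split; [apply/eval_path_expr | apply: agree_refl].
- by move=> G' c d; rewrite xP eval_path_expr.
Qed.

Lemma agree_candidate e :
  e \in candidates F p C -> frag F i.+1 e -> eval e a1 b1 -> eval e a2 b2.
Proof.
move=> eC fe; have [|+ _] := Hagree (e := e); last exact.
by rewrite /= mem_cat mem_filter fe eC orbT.
Qed.

(** The composition of the characteristic expressions of [(a1, c1)] and [(c1, b1)] transfers to
    [(a2, b2)], and any middle node there is the required [c2]. *)
Lemma agree_comp : comp_forth (saturate F) i (agree B) a1 b1 a2 b2.
Proof.
move=> c1; rewrite !pathsF_saturate => /char_exprP[x [xC fx xac xP]].
case/char_exprP=> [y [yC fy ycb yP]].
have [|||c2 [/xP[_ ?] /yP[_ ?]]] := @agree_candidate (EComp x y).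
- by rewrite mem_cat (allpairs_f (fun x y => EComp x y)).
- move: fx fy; rewrite /frag /= ltnS geq_max.
  by case/andP=> -> -> /andP[-> ->].
- by exists c1.
by exists c2.
Qed.

Lemma agree_proj : FProj \in saturate F ->
  proj_forth (saturate F) i (agree B) a1 b1 a2 b2.
Proof.
move=> pF; have eq12 : a1 = b1 -> a2 = b2.
  have: agree (basis L F 0) a1 b1 a2 b2.
    (* Bases are cumulative, so agreement descends to level 0, where [EId] is available. *)
    by move: Hagree; elim: (i.+1) => // j IHj H; apply: IHj => e Be;
      apply: H; rewrite /= mem_cat Be.
  by move/agree_atoms/(_ EId) => H eq1; case: H => //; split.
have [eq1|neq1] := EM (a1 = b1); last by split; [left | move/neq1].
split=> [|_]; first right; first split=> //; first exact: eq12.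
  move=> c1; rewrite pathsF_saturate => /char_exprP[x [xC fx xac xP]].
  have /eval_eproj1[_ [c2 /xP[_ ?]]] : eval (eproj1 F x) a2 b2.
    apply: agree_candidate; first by rewrite !mem_cat map_f ?orbT.
      by case: (frag_eproj HF pF fx).
    by apply/eval_eproj1; split=> //; exists c1.
  by exists c2.
move=> c1; rewrite pathsF_saturate => /char_exprP[x [xC fx xac xP]].
have /eval_eproj2[_ [c2 /xP[_ ?]]] : eval (eproj2 F x) a2 b2.
  apply: agree_candidate; first by rewrite !mem_cat map_f ?orbT.
    by case: (frag_eproj HF pF fx).
  by apply/eval_eproj2; split=> //; exists c1.
by exists c2.
Qed.

(* The separating expression is the path expression itself when [(c, d)] is not
   in the path relation, and otherwise excludes the pairs agreeing with
   [(c, d)]. *)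
Lemma separating_expr (G : structure L) (c d : node G) :
  exists u, [/\ u \in p :: [seq ediff F p x | x <- C], frag F i u,
    ~ eval u c d
    & forall (G' : structure L) (c' d' : node G'),
      pathsF F i c' d' -> ~ agree B c' d' c d -> eval u c' d'].
Proof.
have fp : frag F i p := frag_path_expr L F i.
have [/char_exprP[x [xC fx xcd xP]]|nP] := EM (pathsF F i c d).
  exists (ediff F p x); split; first by rewrite in_cons map_f ?orbT.
  - exact: frag_ediff.
  - by rewrite eval_ediff => -[].
  move=> G' c' d' Pcd nag; rewrite eval_ediff eval_path_expr xP; split=> //.
  by case=> _ /agree_sym.
exists p; split; rewrite ?mem_head ?eval_path_expr // => G' c' d'.
by rewrite eval_path_expr.
Qed.

(** Let [x] characterize [(b2, c2)] and let [u] separate [(a2, c2)]. If no [c1] serves, each [c1]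
    with [x] at [(b1, c1)] is path-related to [a1] with a disagreeing pair, so [u] holds there. Thus
    [u / x] holds at [(a1, b1)], hence at [(a2, b2)], which forces [u] at [(a2, c2)]: a
    contradiction. *)
Lemma agree_lres : FLres \in saturate F ->
  lres_forth (saturate F) i (agree B) a1 b1 a2 b2.
Proof.
move=> lF c2; rewrite pathsF_saturate => /char_exprP[x [xC fx xbc xP]].
have [u [uD fu nu uP]] := separating_expr a2 c2.
apply: contrapT => nex; apply: nu.
have /eval_elres : eval (elres F u x) a2 b2; last exact.
apply: agree_candidate; last first.
- apply/eval_elres => c1 /xP[_ /agree_sym ag]; apply: contrapT => nu.
  apply: nex; exists c1; split=> //; rewrite pathsF_saturate.
  have [Pac|] := EM (pathsF F i a1 c1); [right | by left].
  by apply: contrapT => nag; apply: nu; apply: uP.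
- exact: frag_elres.
by rewrite 4!mem_cat (allpairs_f (elres F)) ?orbT.
Qed.

Lemma agree_rres : FRres \in saturate F ->
  rres_forth (saturate F) i (agree B) a1 b1 a2 b2.
Proof.
move=> rF c2; rewrite pathsF_saturate => /char_exprP[x [xC fx xca xP]].
have [u [uD fu nu uP]] := separating_expr c2 b2.
apply: contrapT => nex; apply: nu.
have /eval_erres : eval (erres F x u) a2 b2; last exact.
apply: agree_candidate; last first.
- apply/eval_erres => c1 /xP[_ /agree_sym ag]; apply: contrapT => nu.
  apply: nex; exists c1; split=> //; rewrite pathsF_saturate.
  have [Pcb|] := EM (pathsF F i c1 b1); [right | by left].
  by apply: contrapT => nag; apply: nu; apply: uP.
- exact: frag_erres.
by rewrite 4!mem_cat (allpairs_f (fun x y => erres F y x)) ?orbT.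
Qed.

End AgreeClauses.

(** Agreement is symmetric in the two structures, so each Back clause is the Forth clause with the
    structures exchanged. *)
Lemma agree_bisimulation (L : finType) (F : {pred feature}) k
  (G1 G2 : structure L) :
  (FCompl \in F) || (FDiff \in F) ->
  bisimulation (saturate F) k (fun i => @agree L (basis L F i) G1 G2).
Proof.
move=> HF; split.
- by move=> i _ a1 b1 a2 b2 H e Be; apply: H; rewrite /= mem_cat Be.
- move=> a1 b1 a2 b2 H; split; first exact: agree_atoms.
  exact: agree_atoms (agree_sym H).
move=> i _ a1 b1 a2 b2 H; have H' := agree_sym H; split.
- split; first exact: agree_comp.
  move=> c2 Hac Hcb; have [c1 [? ?]] := agree_comp HF H' Hac Hcb.
  by exists c1; split; apply: agree_sym.
- move=> pF; split; first exact: agree_proj.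
  have [H1 H2] := agree_proj HF H' pF; split.
    case: H1 => [|[eq2 eq1 H1]]; [by left | right; split=> // c2 /H1[c1 ?]].
    by exists c1; apply: agree_sym.
  by move=> eq2 c2 /(H2 eq2)[c1 ?]; exists c1; apply: agree_sym.
- move=> lF; split; first exact: agree_lres.
  move=> c1 /(agree_lres HF H' lF)[c2 [H1 H2]]; exists c2.
  by split; [apply: agree_sym | case: H2 => [|/agree_sym]; [left | right]].
- move=> rF; split; first exact: agree_rres.
  move=> c1 /(agree_rres HF H' rF)[c2 [H1 H2]]; exists c2.
  by split; [apply: agree_sym | case: H2 => [|/agree_sym]; [left | right]].
Qed.

Theorem theorem4p2 (L : finType) (F : {pred feature}) (k : nat)
    (M1 M2 : marked L) :
  (FCompl \in F) || (FDiff \in F) ->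
  (bisimilar (saturate F) k M1 M2 <-> equiv_upto F k M1 M2).
Proof.
move=> HF; split=> [|eqM]; first exact: bisimilar_equiv.
exists (fun i => @agree L (basis L F i) (base M1) (base M2)).
  exact: agree_bisimulation.
(* Members of [basis L F k] lie in the fragment of [F] itself with degree at most [k], so
   equivalence yields agreement at the marks. *)
by move=> e Be; have /allP/(_ e Be)/andP[] := frag_basis L F k; apply: eqM.
Qed.
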